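(* For each fixed multisegment $\mathfrak m$, the following two implications are equivalent: (i) if $\mathfrak m$ is distinguished, then $\mathfrak m$ is of Speh type; (ii) if both $\mathfrak m$ and $\mathfrak m^\vee$ are distinguished, then $\mathfrak m$ is of Speh type. In particular, the assertion that (i) holds for all multisegments is equivalent to the assertion that (ii) holds for all multisegments.
   Context: A segment is a set $[a,b]=\{a,a+1,\ldots,b\}$ of consecutive integers, $a\le b$; write $\mathbf b([a,b])=a$ (beginning), $\mathbf e([a,b])=b$ (endpoint), and $\mathrm{Sgm}$ for the set of segments. Put $\nu[a,b]=[a+1,b+1]$ and $[a,b]^\vee=[-b,-a]$. A multisegment is a finitely supported function $\mathfrak m:\mathrm{Sgm}\to\mathbb Z_{\ge0}$ (a finite multiset of segments); sums are pointwise; $(\nu\mathfrak m)(\Delta)=\mathfrak m(\nu^{-1}\Delta)$ and $\mathfrak m^\vee(\Delta)=\mathfrak m(\Delta^\vee)$. An order of $\mathfrak m$ is a listing $(\Delta_1,\ldots,\Delta_k)$ in which each segment $\Delta$ occurs exactly $\mathfrak m(\Delta)$ times. Write $[a,b]\prec[a',b']$ if $a<a'$, $b<b'$ and $b\ge a'-1$. An order is standard if $\Delta_i\not\prec\Delta_j$ whenever $i<j$. A decomposition of a segment $\Delta$ is a tuple of segments $(\Delta_1,\ldots,\Delta_r)$, $r\ge1$, with $\mathbf e(\Delta_1)=\mathbf e(\Delta)$, $\mathbf b(\Delta_r)=\mathbf b(\Delta)$ and $\mathbf e(\Delta_{i+1})=\mathbf b(\Delta_i)-1$ for $1\le i\le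 r-1$. A decomposition of an order $(\Delta_1,\ldots,\Delta_k)$ is a choice of a decomposition $(\Delta_{i,1},\ldots,\Delta_{i,k_i})$ of each $\Delta_i$; its index set is $I=\{(i,j):1\le i\le k,\ 1\le j\le k_i\}$, ordered lexicographically ($\prec_{\mathrm{lex}}$), and $(i,j)\ll(i',j')$ means $i<i'$. The decomposition is relevant to the order if there is an involution $\tau:I\to I$ with: (R1) $\tau(i,j+1)\ll\tau(i,j)$ for all $1\le i\le k$, $1\le j\le k_i-1$; (R2) $\tau(\imath)\ne\imath$ for all $\imath\in I$; (R3) $\Delta_\imath=\nu\Delta_{\tau(\imath)}$ whenever $\imath\prec_{\mathrm{lex}}\tau(\imath)$. $\mathfrak m$ is distinguished if every standard order of $\mathfrak m$ admits a relevant decomposition. $\mathfrak m$ is of Speh type if $\mathfrak m=\mathfrak n+\nu\mathfrak n$ for some multisegment $\mathfrak n$. *)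

(* Defs.v *)
From HB Require Import structures.
From mathcomp Require Import all_boot all_order all_algebra.
From mathcomp Require Import finmap multiset.

Set Implicit Arguments.
Unset Strict Implicit.
Unset Printing Implicit Defensive.

Import Order.TTheory GRing.Theory Num.Theory.
Local Open Scope fset_scope.
Local Open Scope mset_scope.
Local Open Scope ring_scope.

(* The segment [a, b] is encoded by its end points (a, b), a <= b; these
   determine the set {a, ..., b} and are determined by it. *)
Record segment := Segment {
  seg_pair : int * int;
  _ : seg_pair.1 <= seg_pair.2 }.

HB.instance Definition _ := [isSub for seg_pair].
HB.instance Definition _ := [Choice of segment by <:].

Definition seg_b (D : segment) : int := (seg_pair D).1.
Definition seg_e (D : segment) : int := (seg_pair D).2.

Lemma seg_be (D : segment) : seg_b D <= seg_e D.
Proof. exact: (valP D). Qed.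

Fact seg_shift_proof (c : int) (D : segment) :
  (seg_b D + c, seg_e D + c).1 <= (seg_b D + c, seg_e D + c).2.
Proof. by rewrite lerD2r seg_be. Qed.

Definition seg_shift (c : int) (D : segment) : segment :=
  Segment (seg_shift_proof c D).

Definition seg_nu : segment -> segment := seg_shift 1.
Definition seg_nuinv : segment -> segment := seg_shift (- 1).

Fact seg_dual_proof (D : segment) :
  (- seg_e D, - seg_b D).1 <= (- seg_e D, - seg_b D).2.
Proof. by rewrite lerN2 seg_be. Qed.

Definition seg_dual (D : segment) : segment := Segment (seg_dual_proof D).

Lemma seg_nuK : cancel seg_nu seg_nuinv.
Proof. by move=> [[a b] ab]; apply: val_inj; rewrite /= !addrK. Qed.

Lemma seg_nuinvK : cancel seg_nuinv seg_nu.
Proof. by move=> [[a b] ab]; apply: val_inj; rewrite /= !subrK. Qed.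

Lemma seg_dualK : involutive seg_dual.
Proof. by move=> [[a b] ab]; apply: val_inj; rewrite /= !opprK. Qed.

Definition seg_prec (D D' : segment) : bool :=
  [&& seg_b D < seg_b D', seg_e D < seg_e D' & seg_b D' - 1 <= seg_e D].

Notation multisegment := {mset segment}.

(* The index sets below are the images of the support; mseg_nuE and
   mseg_dualE show that the defining formulas hold at every segment. *)
Definition mseg_nu (m : multisegment) : multisegment :=
  [fsfun D in seg_nu @` finsupp m => m (seg_nuinv D)].

Definition mseg_dual (m : multisegment) : multisegment :=
  [fsfun D in seg_dual @` finsupp m => m (seg_dual D)].

Lemma mseg_nuE (m : multisegment) D : mseg_nu m D = m (seg_nuinv D).
Proof.
rewrite /mseg_nu fsfunE; case: ifPn => // h; apply/esym/fsfun_dflt.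
by apply: contra h => h; apply/imfsetP; exists (seg_nuinv D); rewrite ?seg_nuinvK.
Qed.

Lemma mseg_dualE (m : multisegment) D : mseg_dual m D = m (seg_dual D).
Proof.
rewrite /mseg_dual fsfunE; case: ifPn => // h; apply/esym/fsfun_dflt.
by apply: contra h => h; apply/imfsetP; exists (seg_dual D); rewrite ?seg_dualK.
Qed.

Definition is_order (m : multisegment) (s : seq segment) : Prop :=
  forall D, count_mem D s = m D.

Definition is_standard (s : seq segment) : bool :=
  pairwise (fun D D' => ~~ seg_prec D D') s.

Definition seg_decomposition (D : segment) (ds : seq segment) : bool :=
  if ds is D1 :: r then
    [&& seg_e D1 == seg_e D,
        seg_b (last D1 r) == seg_b D
      & path (fun E E' => seg_e E' == seg_b E - 1) D1 r]
  else false.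

(* all2 also requires the two sequences to have the same size. *)
Definition order_decomposition (s : seq segment) (dss : seq (seq segment)) :
  bool := all2 seg_decomposition s dss.

(* I = {(i, j)}, with both coordinates numbered from 0. *)
Definition dec_index (dss : seq (seq segment)) : Type :=
  {i : 'I_(size dss) & 'I_(size (nth [::] dss i))}.

Definition dec_pair (dss : seq (seq segment)) (i : 'I_(size dss))
  (j : 'I_(size (nth [::] dss i))) : dec_index dss :=
  existT (fun i : 'I_(size dss) => 'I_(size (nth [::] dss i))) i j.

Definition dec_seg (dss : seq (seq segment)) (u : dec_index dss) : segment :=
  tnth (in_tuple (nth [::] dss (tag u))) (tagged u).

Definition dec_lex (dss : seq (seq segment)) (u v : dec_index dss) : bool :=
  (tag u < tag v)%N || ((tag u == tag v) && (tagged u < tagged v)%N).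

Definition dec_ll (dss : seq (seq segment)) (u v : dec_index dss) : bool :=
  (tag u < tag v)%N.

Definition relevant (dss : seq (seq segment)) : Prop :=
  exists tau : dec_index dss -> dec_index dss,
    [/\ involutive tau,
        forall (i : 'I_(size dss)) (j j' : 'I_(size (nth [::] dss i))),
          j' = j.+1 :> nat -> dec_ll (tau (dec_pair j')) (tau (dec_pair j)),
        forall u, tau u <> u
      & forall u, dec_lex u (tau u) -> dec_seg u = seg_nu (dec_seg (tau u))].

Definition distinguished (m : multisegment) : Prop :=
  forall s, is_order m s -> is_standard s ->
    exists2 dss, order_decomposition s dss & relevant dss.

Definition Speh_type (m : multisegment) : Prop :=
  exists n : multisegment, m = n `+` mseg_nu n.

(* Main.v *)
Require Import Defs.
From mathcomp Require Import all_boot all_order all_algebra.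
From mathcomp Require Import zify.

Set Implicit Arguments.
Unset Strict Implicit.
Unset Printing Implicit Defensive.

Import Order.TTheory GRing.Theory Num.Theory.
Local Open Scope ring_scope.

(** The dual of a distinguished multisegment is distinguished
    ([distinguished_dual]), so the hypotheses of the two implications are
    equivalent, multisegment by multisegment.

    The reason is that listing the duals in reverse turns every structure in
    the definition into itself. Duality reverses the relation [seg_prec], so a
    reversed dual list is standard exactly when the list is. Duality exchanges
    beginnings and endpoints, so the reversed duals of the pieces of a
    decomposition of a segment decompose the dual segment. On index sets this
    is the central symmetry [(i, j) |-> (k + 1 - i, k_i + 1 - j)]; conjugating
    the involution [tau] by it keeps (R1), since the order is reversed both
    among the arguments and among the values, and keeps (R3), since the
    symmetry exchanges the roles of [u] and [tau u] while duality turns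
    [nu] into its inverse. *)

Lemma pairwise_rev (T : Type) (r : rel T) (s : seq T) :
  pairwise r (rev s) = pairwise (fun x y => r y x) s.
Proof.
by elim: s => [|x s IHs] //=; rewrite rev_cons pairwise_rcons all_rev IHs.
Qed.

(** The reversed dual serves both for orders of multisegments and for
    decompositions of a single segment. *)
Definition rev_dual (s : seq segment) : seq segment := rev (map seg_dual s).

Definition rev_dual_dec (dss : seq (seq segment)) : seq (seq segment) :=
  rev (map rev_dual dss).

Lemma rev_dualK : involutive rev_dual.
Proof. by move=> s; rewrite /rev_dual map_rev revK mapK //; exact: seg_dualK. Qed.

Lemma rev_dual_decK : involutive rev_dual_dec.
Proof.
by move=> dss; rewrite /rev_dual_dec map_rev revK mapK //; exact: rev_dualK.
Qed.

Lemma size_rev_dual s : size (rev_dual s) = size s.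
Proof. by rewrite size_rev size_map. Qed.

Lemma size_rev_dual_dec dss : size (rev_dual_dec dss) = size dss.
Proof. by rewrite size_rev size_map. Qed.

Lemma nth_rev_dual D s j : (j < size s)%N ->
  nth D (rev_dual s) j = seg_dual (nth D s (size s - j.+1)).
Proof.
move=> lt_j; rewrite nth_rev ?size_map // (nth_map D) //.
by rewrite ltn_subrL (leq_trans _ lt_j).
Qed.

Lemma nth_rev_dual_dec dss i : (i < size dss)%N ->
  nth [::] (rev_dual_dec dss) i = rev_dual (nth [::] dss (size dss - i.+1)).
Proof.
move=> lt_i; rewrite nth_rev ?size_map // (nth_map [::]) //.
by rewrite ltn_subrL (leq_trans _ lt_i).
Qed.

Lemma seg_b_dual D : seg_b (seg_dual D) = - seg_e D.
Proof. by []. Qed.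

Lemma seg_e_dual D : seg_e (seg_dual D) = - seg_b D.
Proof. by []. Qed.

Lemma seg_nu_dual_nu D : seg_nu (seg_dual (seg_nu D)) = seg_dual D.
Proof.
have opp_succ (x : int) : - (x + 1) + 1 = - x by rewrite opprD subrK.
by apply: val_inj; congr (_, _); exact: opp_succ.
Qed.

Lemma seg_prec_dual D D' : seg_prec (seg_dual D) (seg_dual D') = seg_prec D' D.
Proof. by rewrite /seg_prec !seg_b_dual !seg_e_dual; lia. Qed.

Lemma is_order_rev_dual m s : is_order (mseg_dual m) s -> is_order m (rev_dual s).
Proof.
move=> ord_s D; rewrite -[in RHS](seg_dualK D) -mseg_dualE -ord_s.
rewrite count_rev count_map; apply: eq_count => E /=.
by rewrite -{1}(seg_dualK D) (inj_eq (inv_inj seg_dualK)).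
Qed.

Lemma is_standard_rev_dual s : is_standard (rev_dual s) = is_standard s.
Proof.
rewrite /is_standard /rev_dual pairwise_rev pairwise_map.
by apply: eq_pairwise => D D' /=; rewrite seg_prec_dual.
Qed.

(** This form of the definition is symmetric under reversal. *)
Lemma seg_decompositionE D ds :
  seg_decomposition D ds =
  [&& ds != [::], seg_e (head D ds) == seg_e D, seg_b (last D ds) == seg_b D
    & sorted (fun E E' => seg_e E' == seg_b E - 1) ds].
Proof. by case: ds. Qed.

Lemma seg_decomposition_rev_dual D ds :
  seg_decomposition (seg_dual D) (rev_dual ds) = seg_decomposition D ds.
Proof.
have sortedE : sorted (fun E E' => seg_e E' == seg_b E - 1) (rev_dual ds)
             = sorted (fun E E' => seg_e E' == seg_b E - 1) ds.
  rewrite rev_sorted sorted_map; apply: eq_sorted => E E' /=.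
  by rewrite seg_b_dual seg_e_dual; lia.
have headE : head (seg_dual D) (rev_dual ds) = seg_dual (last D ds).
  case/lastP: {sortedE} ds => [|ds E] //.
  by rewrite /rev_dual map_rcons rev_rcons last_rcons.
have lastE : last (seg_dual D) (rev_dual ds) = seg_dual (head D ds).
  case: {sortedE headE} ds => [|E ds] //.
  by rewrite /rev_dual /= rev_cons last_rcons.
rewrite !seg_decompositionE sortedE headE lastE -!size_eq0 size_rev_dual.
by rewrite seg_b_dual seg_e_dual !eqr_opp; congr (_ && _); rewrite andbCA.
Qed.

Lemma order_decomposition_rev_dual s dss :
  order_decomposition s dss ->
  order_decomposition (rev_dual s) (rev_dual_dec dss).
Proof.
rewrite /order_decomposition !all2E !size_rev_dual size_rev_dual_dec.
case/andP=> eq_sz all_dec; rewrite eq_sz /= /rev_dual /rev_dual_dec.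
rewrite -rev_zip ?size_map ?(eqP eq_sz) // all_rev.
elim: s dss {eq_sz} all_dec => [|D s IHs] [|ds dss] //= /andP[dec_D dec_s].
by rewrite seg_decomposition_rev_dual dec_D IHs.
Qed.

Lemma dec_index_eq dss (u v : dec_index dss) :
  tag u = tag v :> nat -> tagged u = tagged v :> nat -> u = v.
Proof.
case: u v => [i j] [i' j'] /= /val_inj eq_i; case: i' / eq_i j' => j'.
by move=> /val_inj ->.
Qed.

(** An equation [dss' = rev_dual_dec dss], in place of the type
    [dec_index (rev_dual_dec dss)], makes the inverse of [dec_flip] another
    [dec_flip], with no transport along [rev_dual_decK]. *)
Section Flip.

Variables (dss dss' : seq (seq segment)) (dssE : dss' = rev_dual_dec dss).

Fact dec_flip_tag_proof (i : 'I_(size dss)) : (size dss - i.+1 < size dss')%N.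
Proof. by rewrite dssE size_rev_dual_dec ltn_subrL (leq_trans _ (ltn_ord i)). Qed.

Lemma nth_dec_flip (i : 'I_(size dss)) :
  nth [::] dss' (size dss - i.+1) = rev_dual (nth [::] dss i).
Proof.
have lt_i := ltn_ord i; rewrite dssE nth_rev_dual_dec; last by lia.
by congr (rev_dual (nth _ _ _)); lia.
Qed.

Fact dec_flip_tagged_proof (i : 'I_(size dss)) (j : 'I_(size (nth [::] dss i))) :
  (size (nth [::] dss i) - j.+1
     < size (nth [::] dss' (Ordinal (dec_flip_tag_proof i))))%N.
Proof.
by rewrite nth_dec_flip size_rev_dual ltn_subrL (leq_trans _ (ltn_ord j)).
Qed.

Definition dec_flip (u : dec_index dss) : dec_index dss' :=
  dec_pair (Ordinal (dec_flip_tagged_proof (tagged u))).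

Lemma dec_seg_flip u : dec_seg (dec_flip u) = seg_dual (dec_seg u).
Proof.
have D := dec_seg u.
case: u => i j; rewrite /dec_seg !(tnth_nth D) /=.
have lt_j := ltn_ord j; rewrite nth_dec_flip nth_rev_dual; last by lia.
by congr (seg_dual (nth _ _ _)); lia.
Qed.

Lemma dec_ll_flip u v : dec_ll (dec_flip u) (dec_flip v) = dec_ll v u.
Proof.
case: u v => [i j] [i' j']; rewrite /dec_ll /=.
by have := ltn_ord i; have := ltn_ord i'; lia.
Qed.

Lemma dec_lex_flip u v : dec_lex (dec_flip u) (dec_flip v) = dec_lex v u.
Proof.
rewrite /dec_lex -!/(dec_ll _ _) dec_ll_flip; congr (_ || _).
case: u v => [i j] [i' j'] /=; rewrite -!val_eqE /=.
have lt_i := ltn_ord i; have lt_i' := ltn_ord i'.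
have [eq_i|neq_i] := eqVneq (i : nat) i'; last by lia.
move/val_inj: eq_i => eq_i; case: i' / eq_i j' {lt_i'} => j'.
by have := ltn_ord j; have := ltn_ord j'; lia.
Qed.

End Flip.

Lemma dec_flipK dss dss' (h : dss' = rev_dual_dec dss)
    (h' : dss = rev_dual_dec dss') :
  cancel (dec_flip h) (dec_flip h').
Proof.
case=> i j; apply: dec_index_eq => /=.
  by have := ltn_ord i; rewrite h size_rev_dual_dec; lia.
by have := ltn_ord j; rewrite (nth_dec_flip h) size_rev_dual; lia.
Qed.

Lemma relevant_rev_dual dss : relevant dss -> relevant (rev_dual_dec dss).
Proof.
set dss' := rev_dual_dec dss => -[tau [tauK tau1 tau2 tau3]].
have h : dss' = rev_dual_dec dss by [].
have h' : dss = rev_dual_dec dss' by rewrite rev_dual_decK.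
pose f := dec_flip h; pose g := dec_flip h'.
have fK : cancel f g by exact: dec_flipK.
have gK : cancel g f by exact: dec_flipK.
exists (f \o tau \o g); split=> [u | i j j' eq_j | u | u] /=.
- by rewrite fK tauK gK.
- rewrite dec_ll_flip; apply: tau1 => /=.
  by have := ltn_ord j'; lia.
- by move=> eq_u; apply: (tau2 (g u)); rewrite -[in RHS]eq_u fK.
rewrite -(gK u); move: (g u) => v; rewrite fK dec_lex_flip !dec_seg_flip.
(* Being before [v = tau (tau v)], [tau v] is the index to which (R3) applies. *)
by move=> lex_v; rewrite (tau3 (tau v)) tauK // seg_nu_dual_nu.
Qed.

Lemma distinguished_dual m : distinguished m -> distinguished (mseg_dual m).
Proof.
move=> dist_m s ord_s std_s.
have [||dss dec_dss rel_dss] := dist_m (rev_dual s).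
- exact: is_order_rev_dual.
- by rewrite is_standard_rev_dual.
exists (rev_dual_dec dss); last exact: relevant_rev_dual.
by rewrite -(rev_dualK s); exact: order_decomposition_rev_dual.
Qed.

Theorem corollary5p5 :
  (forall m : multisegment,
     (distinguished m -> Speh_type m) <->
     (distinguished m /\ distinguished (mseg_dual m) -> Speh_type m)) /\
  ((forall m : multisegment, distinguished m -> Speh_type m) <->
   (forall m : multisegment,
      distinguished m /\ distinguished (mseg_dual m) -> Speh_type m)).
Proof.
have equiv m : (distinguished m -> Speh_type m) <->
    (distinguished m /\ distinguished (mseg_dual m) -> Speh_type m).
  split=> [H [dist_m _] | H dist_m]; first exact: H.
  by apply: H; split=> //; exact: distinguished_dual.
split; first exact: equiv.
by split=> H m; apply/equiv; exact: H.
Qed.
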